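(* Let $n\ge 2$ be an integer and let $B$ be a non-empty subset of $\{2,3,\dots,n\}$. Then in $K_{0,n}$: $OO_B=0$, $OE_B=0$, $EO_B=0$ and $EE_B=0$.
   Context: $K_{0,n}$ is the real associative algebra with unity generated by $e_1,\dots,e_n$ subject to $e_i^2=-1$ and $e_ie_j=e_je_i$ for all $i,j\in\{1,\dots,n\}$. For $A=\{i_1<\cdots<i_l\}\subseteq\{1,\dots,n\}$ put $e_A:=e_{i_1}\cdots e_{i_l}$, with $e_{\{\}}:=1$; the elements $e_A$, $A\subseteq\{1,\dots,n\}$, form a basis of $K_{0,n}$ as a real vector space (dimension $2^n$). For $U=\sum_A a_Ae_A$ with $a_A\in\mathbb{R}$, the grade-$k$ projection is $\langle U\rangle_k:=\sum_{|A|=k}a_Ae_A$ (zero if $k>n$). Operations of conjugation: for $l\in\{1,\dots,n\}$, $U\mapsto U^{(l)}$ is the linear map on $K_{0,n}$ replacing the generator $e_l$ by $-e_l$, i.e. $e_A^{(l)}=-e_A$ if $l\in A$ and $e_A^{(l)}=e_A$ if $l\notin A$. For $B=\{i_1,\dots,i_k\}\subseteq\{1,\dots,n\}$, $U^{(B)}$ denotes the result of applying the conjugations $(i_1),\dots,(i_k)$ successively (they commute), with $U^{(\{\})}:=U$. Define $f:=\frac{1}{2^{n-1}}\sum_{A\subseteq\{1,\dots,n\}}e_A\in K_{0,n}$, $$E:=\sum_{k=0}^{\lfloor n/2\rfloor}(-1)^k\langle f\rangle_{2k},\qquad O:=\sum_{k=0}^{\lfloor n/2\rfloor}(-1)^k\langle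 f\rangle_{2k+1},$$ and, for $B\subseteq\{2,3,\dots,n\}$, $E_B:=E^{(B)}$ and $O_B:=O^{(B)}$. *)

(* Defs.v *)
From HB Require Import structures.
From mathcomp Require Import all_boot all_order all_algebra.
From mathcomp Require Import reals ring.
Set Implicit Arguments.
Unset Strict Implicit.
Unset Printing Implicit Defensive.
Import Order.TTheory GRing.Theory Num.Theory.
Local Open Scope ring_scope.

Section SymDiff.
Variables (R : pzRingType) (n : nat).
Implicit Types A B C : {set 'I_n}.

Definition symd A B : {set 'I_n} := [set i | (i \in A) (+) (i \in B)].

Lemma symdC A B : symd A B = symd B A.
Proof. by apply/setP => i; rewrite !inE addbC. Qed.
Lemma symdA A B C : symd A (symd B C) = symd (symd A B) C.
Proof. by apply/setP => i; rewrite !inE addbA. Qed.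
Lemma symd0s A : symd set0 A = A.
Proof. by apply/setP => i; rewrite !inE addFb. Qed.
Lemma symdss A : symd A A = set0.
Proof. by apply/setP => i; rewrite !inE addbb. Qed.
Lemma symdK A B : symd A (symd A B) = B.
Proof. by rewrite symdA symdss symd0s. Qed.
Lemma symd_inj A : injective (symd A).
Proof. exact: can_inj (symdK A). Qed.

(* sign in e_A e_B = sgI A B *: e_(symd A B): one factor -1 per common index *)
Definition sgI A B : R := (-1) ^+ #|A :&: B|.

Lemma sgIC A B : sgI A B = sgI B A.
Proof. by rewrite /sgI setIC. Qed.

Lemma sgI0s A : sgI set0 A = 1.
Proof. by rewrite /sgI set0I cards0 expr0. Qed.

Lemma sgIDl A B C : sgI (symd A B) C = sgI A C * sgI B C.
Proof.
rewrite /sgI -exprD -[LHS]signr_odd -[RHS]signr_odd; congr (_ ^+ nat_of_bool _).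
have cardE' (X : {set 'I_n}) : #|X| = (\sum_i (i \in X))%N.
  by rewrite -sum1_card big_mkcond; apply: eq_bigr => i _; case: (i \in X).
have odds (F : 'I_n -> nat) :
    odd (\sum_i F i)%N = \big[addb/false]_i odd (F i).
  by apply: (big_morph odd oddD).
rewrite oddD !cardE' !odds -big_split; apply: eq_bigr => i _; rewrite !inE.
by case: (i \in A); case: (i \in B); case: (i \in C).
Qed.

Lemma sgIDr A B C : sgI A (symd B C) = sgI A B * sgI A C.
Proof. by rewrite sgIC sgIDl !(sgIC A). Qed.
End SymDiff.

(* The algebra K_{0,n} is realised as a twisted group algebra: U : K0 R n is the
   family of its coefficients on the basis e_A, and e_A e_B is
   (-1)^|A :&: B| e_(A symd B), which is forced by e_i ^+ 2 = -1 and
   commutativity. The presentation is recovered in gen_sqr, K0_expand and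
   K0_coef below, where e_A is the product of the generators e_i, i \in A.
   The generator written e_1, ..., e_n on paper is gen i with i : 'I_n, so that
   the i-th ordinal (from 0) stands for the index i.+1. *)
Definition K0 (R : realType) (n : nat) : Type := {ffun {set 'I_n} -> R^o}.

Section Algebra.
Variables (R : realType) (n : nat).
Implicit Types (U V W : K0 R n) (A B C D : {set 'I_n}).

HB.instance Definition _ :=
  GRing.Lmodule.copy (K0 R n) {ffun {set 'I_n} -> R^o}.

Definition K0_delta A : K0 R n := [ffun C => (C == A)%:R].

Definition K0_mul U V : K0 R n :=
  [ffun C => \sum_(A : {set 'I_n})
     sgI R A (symd A C) * (U A * V (symd A C))].

Lemma K0_mulA : associative K0_mul.
Proof.
move=> U V W; apply/ffunP => D; rewrite !ffunE.
under eq_bigr => A _ do rewrite ffunE !mulr_sumr.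
under [RHS]eq_bigr => C _ do rewrite ffunE mulr_suml mulr_sumr.
rewrite [RHS]exchange_big /=; apply: eq_bigr => A _.
rewrite [RHS](reindex_inj (@symd_inj n A)) /=; apply: eq_bigr => B _.
rewrite symdK -!symdA.
have -> : symd B (symd A D) = symd A (symd B D).
  by rewrite !symdA (symdC B).
rewrite !mulrA; congr (_ * W _).
rewrite (sgIDl _ A B) -[in LHS](symdK B (symd A D)).
have -> : symd B (symd A D) = symd A (symd B D).
  by rewrite !symdA (symdC B).
rewrite (sgIDr _ A B); ring.
Qed.

Lemma K0_mulC : commutative K0_mul.
Proof.
move=> U V; apply/ffunP => D; rewrite !ffunE.
have ID : injective (fun A : {set 'I_n} => @symd n A D).
  by move=> A B; rewrite (@symdC n A D) (@symdC n B D); apply: symd_inj.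
rewrite [RHS](reindex_inj ID) /=; apply: eq_bigr => A _.
have -> : symd (symd A D) D = A by rewrite -symdA symdss symdC symd0s.
by rewrite sgIC (mulrC (V _)).
Qed.

Lemma K0_mul1 : left_id (K0_delta set0) K0_mul.
Proof.
move=> U; apply/ffunP => D; rewrite !ffunE (bigD1 set0) //= !ffunE eqxx.
rewrite symd0s sgI0s !mul1r big1 ?addr0 // => A /negPf nA.
by rewrite !ffunE nA mul0r mulr0.
Qed.

Lemma K0_mulDl : left_distributive K0_mul +%R.
Proof.
move=> U V W; apply/ffunP => D; rewrite !ffunE -big_split /=.
by apply: eq_bigr => A _; rewrite !ffunE mulrDl mulrDr.
Qed.

Lemma K0_1neq0 : K0_delta set0 != 0.
Proof.
apply/eqP => /ffunP /(_ set0); rewrite !ffunE eqxx => /eqP.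
by rewrite oner_eq0.
Qed.

HB.instance Definition _ := GRing.Zmodule_isComNzRing.Build (K0 R n)
  K0_mulA K0_mulC K0_mul1 K0_mulDl K0_1neq0.

Lemma K0_scalerAl (a : R) U V : a *: (U * V) = (a *: U) * V.
Proof.
apply/ffunP => D; rewrite !ffunE scaler_sumr; apply: eq_bigr => A _.
by rewrite !ffunE /GRing.scale /= mulrCA !mulrA.
Qed.

HB.instance Definition _ :=
  GRing.Lmodule_isLalgebra.Build R (K0 R n) K0_scalerAl.
HB.instance Definition _ := GRing.Lalgebra_isComAlgebra.Build R (K0 R n).

Definition gen (i : 'I_n) : K0 R n := K0_delta [set i].

Definition basis_e A : K0 R n := \prod_(i in A) gen i.

Lemma K0_deltaM A B :
  K0_delta A * K0_delta B = sgI R A B *: K0_delta (symd A B).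
Proof.
apply/ffunP => D; rewrite !ffunE (bigD1 A) //= !ffunE eqxx mul1r.
rewrite [X in _ + X]big1 ?addr0; last first.
  by move=> C /negPf nC; rewrite !ffunE nC mul0r mulr0.
have -> : (D == symd A B) = (symd A D == B).
  by apply/eqP/eqP => [->|<-]; rewrite symdK.
by case: eqP => [->|_]; rewrite /GRing.scale /= ?mulr1 ?mulr0.
Qed.

Lemma gen_sqr i : gen i ^+ 2 = -1.
Proof. by rewrite expr2 K0_deltaM symdss /sgI setIid cards1 expr1 scaleN1r. Qed.

Lemma basis_eE A : basis_e A = K0_delta A.
Proof.
have [k] := ubnP #|A|; elim: k A => // k IHk A ltAk.
have [->|[i iA]] := set_0Vmem A; first by rewrite /basis_e big_set0.
rewrite /basis_e (big_setD1 i) //= -/(basis_e _) IHk; last first.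
  by move: ltAk; rewrite (cardsD1 i) iA.
rewrite K0_deltaM /sgI.
have -> : [set i] :&: (A :\ i) = set0.
  by apply/setP => j; rewrite !inE; case: (j == i).
rewrite cards0 expr0 scale1r; congr K0_delta; apply/setP => j; rewrite !inE.
by case: eqP => [->|_] //=; rewrite iA.
Qed.

Lemma K0_coef (a : {set 'I_n} -> R) B :
  (\sum_(A : {set 'I_n}) a A *: basis_e A) B = a B.
Proof.
rewrite sum_ffunE (bigD1 B) //= big1 ?addr0.
  by rewrite basis_eE !ffunE eqxx /GRing.scale /= mulr1.
move=> A /negPf nA; rewrite basis_eE !ffunE eq_sym nA /GRing.scale /=.
by rewrite mulr0.
Qed.

Lemma K0_expand U : U = \sum_(A : {set 'I_n}) U A *: basis_e A.
Proof. by apply/ffunP => B; rewrite K0_coef. Qed.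

Definition grade (k : nat) U : K0 R n :=
  \sum_(A : {set 'I_n} | #|A| == k) U A *: basis_e A.

Definition conj1 (l : 'I_n) U : K0 R n :=
  \sum_(A : {set 'I_n}) U A *: (if l \in A then - basis_e A else basis_e A).

(* The maps conj1 l commute, so the order of enum B is immaterial. *)
Definition conjs B U : K0 R n := foldr conj1 U (enum B).

Definition felt : K0 R n :=
  (2 ^+ (n - 1))^-1 *: \sum_(A : {set 'I_n}) basis_e A.

Definition Eelt : K0 R n :=
  \sum_(0 <= k < (n %/ 2).+1) (-1) ^+ k *: grade (2 * k) felt.

Definition Oelt : K0 R n :=
  \sum_(0 <= k < (n %/ 2).+1) (-1) ^+ k *: grade (2 * k + 1) felt.

End Algebra.

Arguments gen R {n} i.
Arguments basis_e R {n} A.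
Arguments felt R n : clear implicits.
Arguments Eelt R n : clear implicits.
Arguments Oelt R n : clear implicits.

(* Main.v *)
Require Import Defs.
From mathcomp Require Import all_boot all_order all_algebra.
From mathcomp Require Import reals.
Local Open Scope ring_scope.

(** After adjoining a square root i of -1, the elements E and O become the two
    parts of a product: up to the factor 1 / 2 ^ (n - 1), E + i O is the product
    of the factors 1 + i e_j over all j. Since e_j (1 + i e_j) =
    - i (1 + i e_j), every generator acts on this product as - i. Back over the
    reals this says that e_j E = O and e_j O = - E for every j
    ([gen_mulE], [gen_mulO]).

    Conjugation along B is multiplicative and sends e_j to - e_j exactly when j
    belongs to B, so e_j E_B = O_B for j outside B while e_l E_B = - O_B for l
    in B ([conjs_Eelt_gen]). Take the first generator, which is outside B, and
    some l in B. Then O E_B = e_1 E E_B = E O_B and O E_B = e_l E E_B = - E O_B,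
    so both products vanish; multiplying them by e_1 gives the other two. *)

Import GRing.Theory Num.Theory.

Section EvenOddParts.
Set Implicit Arguments.
Unset Strict Implicit.
Unset Printing Implicit Defensive.
Variables (R : realType) (n : nat).
Implicit Types (U V : K0 R n) (A B C : {set 'I_n}).

Lemma grade_coef k U C : (grade k U) C = if #|C| == k then U C else 0.
Proof.
rewrite /grade big_mkcond.
rewrite -[RHS](K0_coef (fun A => if #|A| == k then U A else 0)).
congr (fun_of_fin _ C); apply: eq_bigr => A _.
by case: ifP; rewrite ?scale0r.
Qed.

Lemma conj1_coef l U C : (conj1 l U) C = (-1) ^+ (l \in C) * U C.
Proof.
rewrite /conj1 -(K0_coef (fun A => (-1) ^+ (l \in A) * U A)).
congr (fun_of_fin _ C); apply: eq_bigr => A _.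
by case: (l \in A); rewrite ?expr1 ?expr0 ?mul1r // mulN1r scaleNr scalerN.
Qed.

Lemma conjs_coef B U C : (conjs B U) C = sgI R B C * U C.
Proof.
have foldr_coef s :
    (foldr (@conj1 R n) U s) C = (-1) ^+ count (mem C) s * U C.
  elim: s => [|l s IHs] /=; first by rewrite mul1r.
  by rewrite conj1_coef IHs mulrA -exprD.
rewrite /conjs foldr_coef /sgI; congr (_ ^+ _ * _).
rewrite [RHS]cardE /enum_mem count_filter size_filter.
by apply: eq_count => i; rewrite !inE andbC.
Qed.

(** The coefficient signs of conjugation are characters of the group of subsets
    under symmetric difference, and the product is graded by that group. *)
Lemma conjsM B U V : conjs B (U * V) = conjs B U * conjs B V.
Proof.
apply/ffunP => C; rewrite conjs_coef !ffunE mulr_sumr; apply: eq_bigr => A _.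
rewrite !conjs_coef -{1}(symdK A C) sgIDr mulrCA.
by congr (_ * _); rewrite mulrACA.
Qed.

Lemma conjs_gen B j :
  conjs B (gen R j) = if j \in B then - gen R j else gen R j.
Proof.
apply/ffunP => C; rewrite conjs_coef /gen.
have -> : (if j \in B then - K0_delta R [set j] else K0_delta R [set j]) C
    = (-1) ^+ (j \in B) * (K0_delta R [set j]) C.
  by case: (j \in B); rewrite ?mul1r // expr1 mulN1r ffunE.
rewrite !ffunE; case: eqP => [->|_]; last by rewrite !mulr0.
rewrite /sgI; congr ((-1) ^+ _ * _).
have [jB|jNB] := boolP (j \in B).
  by rewrite (setIidPr _) ?cards1 // sub1set.
by apply/eqP; rewrite cards_eq0 setI_eq0 disjoint_sym disjoints1.
Qed.

Lemma felt_coef C : (felt R n) C = (2 ^+ (n - 1))^-1.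
Proof.
rewrite /felt scaler_sumr.
exact: (K0_coef (fun=> (2 ^+ (n - 1))^-1)).
Qed.

(** For g k = 2 k and g k = 2 k + 1 the sum is E or O: each grade occurs at most
    once in it, so a coefficient picks up one sign or is dropped. *)
Lemma sum_grade_coef (g : nat -> nat) U C m :
  injective g -> (forall k, #|C| = g k -> k < m)%N ->
  (forall k, #|C| = g k ->
    (\sum_(0 <= k < m) (-1) ^+ k *: grade (g k) U) C = (-1) ^+ k * U C) /\
  ((forall k, #|C| <> g k) ->
    (\sum_(0 <= k < m) (-1) ^+ k *: grade (g k) U) C = 0).
Proof.
move=> g_inj gm; rewrite big_mkord sum_ffunE.
have coefE k : ((-1) ^+ k *: grade (g k) U) C =
    (-1) ^+ k * (if #|C| == g k then U C else 0).
  by rewrite ffunE grade_coef.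
split=> [k Ck|Cg].
  rewrite (bigD1 (Ordinal (gm k Ck))) //= coefE Ck eqxx big1 ?addr0 // => i.
  move=> ik; rewrite coefE Ck; case: eqP => [/g_inj ki|_]; last exact: mulr0.
  by case/eqP: ik; apply: val_inj.
by apply: big1 => i _; rewrite coefE; case: eqP => [/Cg|_] //; exact: mulr0.
Qed.

Lemma Eelt_coef C :
  (Eelt R n) C = if odd #|C| then 0
                 else (-1) ^+ #|C|./2 * (2 ^+ (n - 1))^-1.
Proof.
have Cn : (#|C| <= n)%N by rewrite -[leqRHS]card_ord max_card.
have g_inj : injective (fun k => 2 * k)%N.
  by move=> i j /eqP; rewrite eqn_pmul2l // => /eqP.
have [|evenE oddE] := @sum_grade_coef _ (felt R n) C (n %/ 2).+1 g_inj.
  by move=> k Ck; rewrite ltnS leq_divRL // mulnC -Ck.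
case: ifPn => oC.
  by apply: oddE => k Ck; rewrite Ck mul2n odd_double in oC.
rewrite -(felt_coef C); apply: evenE.
by rewrite mul2n even_halfK.
Qed.

Lemma Oelt_coef C :
  (Oelt R n) C = if odd #|C| then (-1) ^+ #|C|./2 * (2 ^+ (n - 1))^-1
                 else 0.
Proof.
have Cn : (#|C| <= n)%N by rewrite -[leqRHS]card_ord max_card.
have g_inj : injective (fun k => 2 * k + 1)%N.
  by move=> i j /eqP; rewrite eqn_add2r eqn_pmul2l // => /eqP.
have [|oddE evenE] := @sum_grade_coef _ (felt R n) C (n %/ 2).+1 g_inj.
  move=> k Ck; rewrite ltnS leq_divRL // mulnC.
  by apply: leq_trans Cn; rewrite Ck leq_addr.
case: ifPn => oC.
  rewrite -(felt_coef C); apply: oddE.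
  by rewrite mul2n addn1 odd_halfK // prednK // odd_gt0.
by apply: evenE => k Ck; rewrite Ck mul2n addn1 /= odd_double in oC.
Qed.

Lemma gen_mul_coef j U C :
  (gen R j * U) C = if j \in C then U (C :\ j) else - U (j |: C).
Proof.
rewrite ffunE (bigD1 [set j]) //= big1 ?addr0; last first.
  by move=> A /negPf nA; rewrite ffunE nA mul0r mulr0.
rewrite ffunE eqxx mul1r /sgI; case: ifPn => jC.
  have -> : symd [set j] C = C :\ j.
    by apply/setP => i; rewrite !inE; case: eqP => [->|_] //=; rewrite jC.
  have -> : [set j] :&: (C :\ j) = set0.
    by apply/setP => i; rewrite !inE; case: eqP.
  by rewrite cards0 mul1r.
have -> : symd [set j] C = j |: C.
  by apply/setP => i; rewrite !inE; case: eqP => [->|_] //=; rewrite (negPf jC).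
by rewrite (setIidPl _) ?sub1set ?setU11 // cards1 expr1 mulN1r.
Qed.

(** Multiplication by e_j moves the coefficients by one grade. The signs of E
    and O change from each grade that occurs to the next one, and the minus sign
    that e_j ^+ 2 = -1 produces on the e_C with j outside C matches that change. *)
Lemma gen_mulE j : gen R j * Eelt R n = Oelt R n.
Proof.
apply/ffunP => C; rewrite gen_mul_coef Oelt_coef !Eelt_coef.
case: ifPn => jC.
  rewrite (cardsD1 j C) jC add1n /= uphalf_half.
  by case: (odd #|C :\ j|).
rewrite cardsU1 jC add1n /= uphalf_half.
case: (odd #|C|); last by rewrite oppr0.
by rewrite add1n exprS mulN1r mulNr opprK.
Qed.

Lemma gen_mulO j : gen R j * Oelt R n = - Eelt R n.
Proof. by rewrite -(gen_mulE j) mulrA -expr2 gen_sqr mulN1r. Qed.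

Lemma conjs_Eelt_gen B j :
  gen R j * conjs B (Eelt R n) =
    if j \in B then - conjs B (Oelt R n) else conjs B (Oelt R n).
Proof.
rewrite -(gen_mulE j) conjsM conjs_gen.
by case: (j \in B); rewrite ?mulNr ?opprK.
Qed.

(** [K0 R n] has no 2-torsion, being a real vector space. *)
Lemma K0_eq_opp U : U = - U -> U = 0.
Proof.
move=> UN; have /eqP : 2%:R *: U = 0 by rewrite scaler_nat mulr2n {2}UN subrr.
by rewrite scaler_eq0 pnatr_eq0 => /eqP.
Qed.

(** Since O = e_i E for every i, the factor e_i of O E_B can be moved onto E_B.
    As B separates j from l, doing so with i = j and with i = l gives opposite
    values. *)
Lemma mul_conjs_eq0 B j l : j \notin B -> l \in B ->
  [/\ Oelt R n * conjs B (Oelt R n) = 0,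
      Oelt R n * conjs B (Eelt R n) = 0,
      Eelt R n * conjs B (Oelt R n) = 0
    & Eelt R n * conjs B (Eelt R n) = 0].
Proof.
move=> jB lB.
have swap i : Oelt R n * conjs B (Eelt R n) =
    Eelt R n * (gen R i * conjs B (Eelt R n)).
  by rewrite -(gen_mulE i) -mulrA mulrCA.
have OE_EO : Oelt R n * conjs B (Eelt R n) = Eelt R n * conjs B (Oelt R n).
  by rewrite (swap j) conjs_Eelt_gen (negPf jB).
have EO0 : Eelt R n * conjs B (Oelt R n) = 0.
  by apply: K0_eq_opp; rewrite -{1}OE_EO (swap l) conjs_Eelt_gen lB mulrN.
have OE0 : Oelt R n * conjs B (Eelt R n) = 0 by rewrite OE_EO.
split=> //; first by rewrite -{1}(gen_mulE j) -mulrA EO0 mulr0.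
rewrite -[Eelt R n in X in X * _]opprK -(gen_mulO j) mulNr -mulrA OE0.
by rewrite mulr0 oppr0.
Qed.

End EvenOddParts.

Theorem lemma6p8 (R : realType) (n : nat) (hn : (2 <= n)%N)
    (B : {set 'I_n}) (hB0 : B != set0)
    (hB : B \subset [set i : 'I_n | (2 <= i.+1)%N]) :
  [/\ Oelt R n * conjs B (Oelt R n) = 0,
      Oelt R n * conjs B (Eelt R n) = 0,
      Eelt R n * conjs B (Oelt R n) = 0
    & Eelt R n * conjs B (Eelt R n) = 0].
Proof.
have [l lB] := set0Pn _ hB0.
have n_gt0 : (0 < n)%N by apply: ltnW.
apply: (@mul_conjs_eq0 R n B (Ordinal n_gt0) l) => //.
by apply/negP => /(subsetP hB); rewrite inE.
Qed.
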